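(* For every natural number $n$, every finite set of formulas $\Gamma$ and every formula $A$ of $\mathscr{L}$: $\Gamma \models_n A$ if and only if $\Gamma \models^\alpha_n A$.
   Context: LANGUAGE. $\mathscr{L}$ is the propositional language whose formulas are built from infinitely many propositional letters and the atomic constant $\bot$ by $\wedge,\vee,\rightarrow$; $\neg X := X \rightarrow \bot$. $\mathrm{ATOM}$ is the set of the letters together with $\bot$. $\Gamma,\Delta$ always range over finite sets of formulas. ATOMIC RULES. A rule of level $0$ is an atom (an axiom). A rule of level $1$ infers an atom $A$ from atoms $A_1,\dots,A_m$. For $k\ge 1$, if $\Re_1,\dots,\Re_m$ are finite sets of atomic rules (some possibly empty) of maximal level $k-1$, then $([\Re_1]A_1,\dots,[\Re_m]A_m)/A$, which infers the atom $A$ from the atoms $A_1,\dots,A_m$ and discharges the rules in $\Re_i$ in the derivation of the $i$-th premise, is a rule of level $k+1$. ATOMIC BASES. An atomic base is a (possibly infinite) set $\mathfrak{B}$ of atomic rules containing the explosion rule $\bot/A$ for every atom $A$; its level is the maximal level of its rules other than the explosion rules ($0$ if there are none). $\mathbb{B}^n$ is the set of bases of level $\le n$. $\mathfrak{C}\supseteq_n\mathfrak{B}$ means $\mathfrak{C}\supseteq\mathfrak{B}$ and $\mathfrak{C}\in\mathbb{B}^n$. Derivations in $\mathfrak{B}$ are defined inductively: an atom $A$ is a single-node derivation of $A$, from no assumed rules if the axiom $A\in\mathfrak{B}$ is applied, and from the assumed rule $A$ if $A$ is assumed; if $\mathscr{D}_i$ derives $A_i$ from assumed rules $\mathfrak{C}_i\cup\Re_i$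 ($i\le m$), then applying $R=([\Re_1]A_1,\dots,[\Re_m]A_m)/A$ yields a derivation of $A$ from $\bigcup_i\mathfrak{C}_i$ if $R\in\mathfrak{B}$, and from $\bigcup_i\mathfrak{C}_i\cup\{R\}$ if $R\notin\mathfrak{B}$. $\vdash_{\mathfrak{B}}A$ means that there is a derivation of $A$ in $\mathfrak{B}$ from no assumed rules (a closed derivation). STANDARD BASE SEMANTICS. For $\mathfrak{B}\in\mathbb{B}^n$, define: for $A\in\mathrm{ATOM}$, $\models_{\mathfrak{B},n}A$ iff $\vdash_{\mathfrak{B}}A$; $\models_{\mathfrak{B},n}B\wedge C$ iff $\models_{\mathfrak{B},n}B$ and $\models_{\mathfrak{B},n}C$; $\models_{\mathfrak{B},n}B\vee C$ iff $\models_{\mathfrak{B},n}B$ or $\models_{\mathfrak{B},n}C$; $\models_{\mathfrak{B},n}B\rightarrow C$ iff $B\models_{\mathfrak{B},n}C$; for $\Gamma\ne\emptyset$, $\Gamma\models_{\mathfrak{B},n}A$ iff for all $\mathfrak{C}\supseteq_n\mathfrak{B}$, if $\models_{\mathfrak{C},n}B$ for all $B\in\Gamma$ then $\models_{\mathfrak{C},n}A$. $\Gamma\models_nA$ iff $\Gamma\models_{\mathfrak{B},n}A$ for all $\mathfrak{B}\in\mathbb{B}^n$. REDUCIBILITY SEMANTICS. An argument structure $\mathscr{D}=\langle T,\langle f,h,g\rangle\rangle$ consists of a finite rooted tree $T$ with nodes labelled by formulas ($\mu\prec\nu$ means that $\nu$ lies below $\mu$, towards the root), whose leaves are partitioned into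 assumption leaves $\mathrm{as}(T)$ and axiom leaves $\mathrm{ax}(T)$, and of partial discharge functions: $f$ is defined on a subset of $\mathrm{as}(T)$ with $\mu\prec f(\mu)$; $h$ is defined on a subset of $\mathrm{ax}(T)$ with $\mu\prec h(\mu)$, where $h(\mu)$ and its children are labelled by atoms and $h(\mu)$ is not a value of $f$; $g$ is defined on a set of sets $K$ of edges, each $K$ consisting of all and only the edges linking a node $\mu_K$ to its children, where $\mu_K$ and its children are labelled by atoms, $\mu_K$ is not a value of $f$, $\mu_K\prec g(K)$, $g(K)$ and its children are labelled by atoms, and $g(K)$ is not a value of $f$. ($f$ discharges assumptions; $h$ and $g$ discharge assumed atomic rules of level $0$ and higher.) The root label is the conclusion. $\mathscr{D}$ is from $\Gamma$ to $A$ if $\Gamma$ is the set of its undischarged assumptions and $A$ its conclusion; it is closed if $\Gamma=\emptyset$, open otherwise. Derivations in $\mathfrak{B}$ are regarded as argument structures with all labels atomic and $f$ empty. $\mathscr{D}[\mathscr{D}^{**}/\mathscr{D}^*]$ is the result of replacing the sub-structure $\mathscr{D}^*$ by $\mathscr{D}^{**}$ in $\mathscr{D}$, the discharge functions being redefined in the natural way (discharges of surviving or copied assumptions and assumed rules take place at the corresponding nodes; the others disappear). If $\mathscr{D}$ is from $\Gamma=\{\mu_1,\dots,\mu_m\}$ and $\sigma$ assigns to each $\mu_i$ an argument structure $\sigma(\mu_i)$ with the same conclusion as $\mu_i$, then $\mathscr{D}^\sigma=\mathscr{D}[\sigma(\mu_1),\dots,\sigma(\mu_m)/\mu_1,\dots,\mu_m]$;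 it is a closed $\sigma$-instance if all $\sigma(\mu_i)$ are closed. An inference is a triple $\langle\langle\mathscr{D}_1,\dots,\mathscr{D}_m\rangle,A,\delta\rangle$ with $\delta$ an extension of the discharge functions of the $\mathscr{D}_i$; its associated argument structure joins the trees of the $\mathscr{D}_i$ by a new root $A$ and adds the discharges $\delta$. A rule is a (recursive) set of inferences, its instances. Introduction rules are Gentzen's: $A,B/A\wedge B$; $A_i/A_1\vee A_2$ ($i=1,2$); $[A]B/A\rightarrow B$. $\mathscr{D}$ is canonical if it is associated to an instance of an introduction rule. A reduction for a rule $R$ is a map $\phi$ from and to argument structures, defined on some set $\mathbb{D}$ of argument structures associated to instances of $R$, such that for all $\mathscr{D}\in\mathbb{D}$: (a) if $\mathscr{D}$ is from $\Gamma$ to $A$, then $\phi(\mathscr{D})$ is from some $\Gamma^*\subseteq\Gamma$ to $A$; (b) for all $\sigma$, $\phi$ is defined on $\mathscr{D}^\sigma$ and $\phi(\mathscr{D}^\sigma)=\phi(\mathscr{D})^\sigma$. For a set $\mathfrak{J}$ of reductions, $\mathscr{D}\leq_{\mathfrak{J}}\mathscr{D}^*$ is the reflexive-transitive closure of: $\mathscr{D}^*=\mathscr{D}[\phi(\mathscr{D}^{**})/\mathscr{D}^{**}]$ for some sub-structure $\mathscr{D}^{**}$ of $\mathscr{D}$ and some $\phi\in\mathfrak{J}$. An argument is a pair $\langle\mathscr{D},\mathfrak{J}\rangle$. It is $n$-valid on $\mathfrak{B}\in\mathbb{B}^n$ iff: when $\mathscr{D}$ is closed with atomic conclusion, $\mathscr{D}\leq_{\mathfrak{J}}\mathscr{D}^*$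 for some closed derivation $\mathscr{D}^*$ in $\mathfrak{B}$; when $\mathscr{D}$ is closed with non-atomic conclusion, $\mathscr{D}\leq_{\mathfrak{J}}\mathscr{D}^*$ for some canonical $\mathscr{D}^*$ whose immediate sub-structures, paired with $\mathfrak{J}$, are $n$-valid on $\mathfrak{B}$; when $\mathscr{D}$ is open with undischarged assumptions $\Gamma$, for all $\sigma$ assigning closed structures, all sets of reductions $\mathfrak{J}^+\supseteq\mathfrak{J}$ and all $\mathfrak{C}\supseteq_n\mathfrak{B}$, if $\langle\sigma(\mu),\mathfrak{J}^+\rangle$ is $n$-valid on $\mathfrak{C}$ for all $\mu\in\Gamma$, then $\langle\mathscr{D}^\sigma,\mathfrak{J}^+\rangle$ is $n$-valid on $\mathfrak{C}$. An argument is $n$-valid iff it is $n$-valid on every $\mathfrak{B}\in\mathbb{B}^n$. $\Gamma\models^\alpha_nA$ means that there is an $n$-valid argument $\langle\mathscr{D},\mathfrak{J}\rangle$ with $\mathscr{D}$ from $\Gamma$ to $A$. *)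

(* Defs.v *)
From HB Require Import structures.
From mathcomp Require Import all_boot.
From Stdlib Require Import Relation_Operators.
From Stdlib Require List.

Set Implicit Arguments.
Unset Strict Implicit.
Unset Printing Implicit Defensive.

(** * Language *)

Inductive atom := Letter of nat | Falsum.

Inductive formula :=
  | Atom of atom
  | And of formula & formula
  | Or of formula & formula
  | Imp of formula & formula.

Lemma atom_comparable : comparable atom.
Proof. by rewrite /comparable /decidable; do 2 decide equality. Defined.
HB.instance Definition _ := hasDecEq.Build atom (compareP atom_comparable).

Lemma formula_comparable : comparable formula.
Proof. by rewrite /comparable /decidable; do 3 decide equality. Defined.
HB.instance Definition _ :=
  hasDecEq.Build formula (compareP formula_comparable).

Definition atomic (F : formula) : bool := if F is Atom _ then true else false.

(** * Atomic rules and bases *)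

(* [ARule [:: (R1, A1); ...; (Rm, Am)] A] is ([R1]A1, ..., [Rm]Am)/A.  The
   finite sets R_i are given by lists; [eqvr] identifies two rules that differ
   only in how these sets are listed, at any depth. *)
Inductive arule := ARule of seq (seq arule * atom) & atom.

Fixpoint eqvr (r s : arule) : bool :=
  let: ARule ps a := r in
  let: ARule qs b := s in
  (a == b) &&
  all2 (fun p q => [&& p.2 == q.2,
                       all (fun x => has (eqvr x) q.1) p.1 &
                       all (fun y => has (fun x => eqvr x y) p.1) q.1]) ps qs.

(* The level is 0 without premises; otherwise it is 1 if nothing is discharged,
   and 2 plus the maximal level of the discharged rules if something is. *)
Fixpoint level (r : arule) : nat :=
  let: ARule ps _ := r in
  if ps is [::] then 0
  else foldr maxn 1
         (flatten (map (fun p => map (fun x => (level x).+2) p.1) ps)).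

Definition explosion (a : atom) : arule := ARule [:: ([::], Falsum)] a.

Record base := Base {
  in_base :> arule -> Prop;
  base_eqvr : forall r s, eqvr r s -> in_base r -> in_base s;
  base_explosion : forall a, in_base (explosion a)
}.

Definition base_level_le (n : nat) (B : base) : Prop :=
  forall r, B r -> (exists a, r = explosion a) \/ level r <= n.

Definition extends (n : nat) (B C : base) : Prop :=
  (forall r, B r -> C r) /\ base_level_le n C.

(** * Argument structures *)

(* The discharge functions map nodes to nodes strictly below them, so the value
   at a node is recorded at that node as a distance: [Some d] is the (d+1)-th
   node met on the way to the root ([Some 0] is the immediate successor), and
   [None] says that the function is undefined.  The annotation is the value of f
   on assumption leaves [As], of h on axiom leaves [Ax], and, on an inner node
   [Node], the value of g on the set of all edges from that node to its
   children. *)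
Inductive tree :=
  | As of formula & option nat
  | Ax of formula & option nat
  | Node of formula & option nat & seq tree.

Definition label (T : tree) : formula :=
  match T with As F _ => F | Ax F _ => F | Node F _ _ => F end.

(* [f_hits k T]: some assumption leaf of T has as f-value the k-th (from 0)
   node below the root of T. *)
Fixpoint f_hits (k : nat) (T : tree) : bool :=
  match T with
  | As _ o => o == Some k
  | Ax _ _ => false
  | Node _ _ ts => has (f_hits k.+1) ts
  end.

(* An inner node that is labelled, like all its children, by an atom and is not
   a value of f: what is required of the values of h and g, and of mu_K. *)
Definition rule_node (T : tree) : bool :=
  if T is Node F _ ts
  then [&& atomic F, all (fun t => atomic (label t)) ts & ~~ has (f_hits 0) ts]
  else false.

(* The list [ctx] has one entry per node below T, nearest first, telling whether
   that node is a [rule_node]. *)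
Fixpoint wf (ctx : seq bool) (T : tree) : bool :=
  match T with
  | As _ o => if o is Some d then d < size ctx else true
  | Ax _ o => if o is Some d then nth false ctx d else true
  | Node _ o ts =>
      [&& ~~ nilp ts,
          (if o is Some d then rule_node T && nth false ctx d else true) &
          all (wf (rule_node T :: ctx)) ts]
  end.

Definition arg_structure (T : tree) : bool := wf [::] T.

(* A subtree S of a structure D may contain discharges at nodes of D below the
   root of S.  [trunc 0 S] forgets them; it is the sub-structure of D given by
   S.  The argument k is the depth reached in S. *)
Definition cut (k : nat) (o : option nat) : option nat :=
  if o is Some d then (if d < k then Some d else None) else None.

Fixpoint trunc (k : nat) (T : tree) : tree :=
  match T with
  | As F o => As F (cut k o)
  | Ax F o => Ax F (cut k o)
  | Node F o ts => Node F (cut k o) (map (trunc k.+1) ts)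
  end.

(* The assumptions of a subtree S (for k = 0) that are not discharged within S,
   each with its outer discharge: [Some j] if it is discharged at the j-th (from
   0) node below the root of S, [None] if it is not discharged at all. *)
Fixpoint loose_as (k : nat) (T : tree) : seq (formula * option nat) :=
  match T with
  | As F None => [:: (F, None)]
  | As F (Some d) => if d < k then [::] else [:: (F, Some (d - k))]
  | Ax _ _ => [::]
  | Node _ _ ts => flatten (map (loose_as k.+1) ts)
  end.

(* Likewise for the values of h and g lying below the root of S; an assumed rule
   application is described by the labels of its node and of its children. *)
Definition outer (k : nat) (o : option nat) : seq nat :=
  if o is Some d then (if d < k then [::] else [:: d - k]) else [::].

Fixpoint loose_ax (k : nat) (T : tree) : seq (formula * nat) :=
  match T with
  | As _ _ => [::]
  | Ax F o => [seq (F, j) | j <- outer k o]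
  | Node _ _ ts => flatten (map (loose_ax k.+1) ts)
  end.

Fixpoint loose_app (k : nat) (T : tree) : seq (formula * seq formula * nat) :=
  match T with
  | As _ _ => [::]
  | Ax _ _ => [::]
  | Node F o ts =>
      [seq (F, map label ts, j) | j <- outer k o]
      ++ flatten (map (loose_app k.+1) ts)
  end.

Definition open_as (D : tree) : seq formula := map fst (loose_as 0 D).

Definition is_closed (D : tree) : bool := nilp (open_as D).

Definition from_to (Gamma : seq formula) (A : formula) (D : tree) : Prop :=
  [/\ arg_structure D, open_as D =i Gamma & label D = A].

Definition assignment (D : tree) (sigma : formula -> tree) : Prop :=
  forall F, F \in open_as D -> arg_structure (sigma F) /\ label (sigma F) = F.

(* D^sigma. *)
Fixpoint subst (sigma : formula -> tree) (T : tree) : tree :=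
  match T with
  | As F None => sigma F
  | As F (Some d) => As F (Some d)
  | Ax F o => Ax F o
  | Node F o ts => Node F o (map (subst sigma) ts)
  end.

(** * Derivations in a base *)

(* In [derivation B ctx T a], the list [ctx] has one entry per node below T,
   nearest first: the set of rules which the rule applied at that node discharges
   in the derivation of the premise leading to T.  [applied B ctx r o] says that
   r is available: from the base if undischarged, and otherwise as an assumed
   rule discharged at the node given by o.  So a derivation for the empty [ctx]
   is closed. *)
Definition applied (B : base) (ctx : seq (seq arule)) (r : arule)
    (o : option nat) : Prop :=
  if o is Some d then has (eqvr r) (nth [::] ctx d) else B r.

Inductive derivation (B : base) : seq (seq arule) -> tree -> atom -> Prop :=
  | der_leaf ctx a o :
      applied B ctx (ARule [::] a) o ->
      derivation B ctx (Ax (Atom a) o) a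
  | der_node ctx p ps a o ts :
      applied B ctx (ARule (p :: ps) a) o ->
      (* an application of a rule of the base is not an assumed one *)
      (o <> None -> ~ B (ARule (p :: ps) a)) ->
      derivations B ctx (p :: ps) ts ->
      derivation B ctx (Node (Atom a) o ts) a
with derivations (B : base) :
    seq (seq arule) -> seq (seq arule * atom) -> seq tree -> Prop :=
  | ders_nil ctx : derivations B ctx [::] [::]
  | ders_cons ctx R a ps t ts :
      derivation B (R :: ctx) t a ->
      derivations B ctx ps ts ->
      derivations B ctx ((R, a) :: ps) (t :: ts).

Definition closed_derivation (B : base) (D : tree) : Prop :=
  exists a, derivation B [::] D a.

Definition derivable (B : base) (a : atom) : Prop :=
  exists D, derivation B [::] D a.

(** * Standard base semantics *)

Fixpoint sat (n : nat) (A : formula) (B : base) : Prop :=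
  match A with
  | Atom a => derivable B a
  | And A1 A2 => sat n A1 B /\ sat n A2 B
  | Or A1 A2 => sat n A1 B \/ sat n A2 B
  | Imp A1 A2 => forall C, extends n B C -> sat n A1 C -> sat n A2 C
  end.

Definition consequence_on (n : nat) (B : base) (Gamma : seq formula)
    (A : formula) : Prop :=
  if Gamma is [::] then sat n A B
  else forall C, extends n B C ->
         (forall F, F \in Gamma -> sat n F C) -> sat n A C.

Definition consequence (n : nat) (Gamma : seq formula) (A : formula) : Prop :=
  forall B, base_level_le n B -> consequence_on n B Gamma A.

(** * Recursive sets *)

(* Kleene's partial recursive functions of several arguments. *)
Inductive recfun :=
  | RZero
  | RSucc
  | RProj of nat
  | RComp of recfun & seq recfun
  | RPrec of recfun & recfun
  | RMin of recfun.

Inductive reval : recfun -> seq nat -> nat -> Prop :=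
  | rev_zero v : reval RZero v 0
  | rev_succ x v : reval RSucc (x :: v) x.+1
  | rev_proj i v : i < size v -> reval (RProj i) v (nth 0 v i)
  | rev_comp f gs v w y :
      revals gs v w -> reval f w y -> reval (RComp f gs) v y
  | rev_prec0 f g v y : reval f v y -> reval (RPrec f g) (0 :: v) y
  | rev_precS f g m v x y :
      reval (RPrec f g) (m :: v) x -> reval g (m :: x :: v) y ->
      reval (RPrec f g) (m.+1 :: v) y
  | rev_min f v m :
      reval f (m :: v) 0 ->
      (forall i, i < m -> exists x, reval f (i :: v) x.+1) ->
      reval (RMin f) v m
with revals : seq recfun -> seq nat -> seq nat -> Prop :=
  | revs_nil v : revals [::] v [::]
  | revs_cons g gs v x w :
      reval g v x -> revals gs v w -> revals (g :: gs) v (x :: w).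

Definition code_atom (a : atom) : nat := if a is Letter p then p.+1 else 0.

Fixpoint code_formula (F : formula) : nat :=
  CodeSeq.code
    match F with
    | Atom a => [:: 0; code_atom a]
    | And A B => [:: 1; code_formula A; code_formula B]
    | Or A B => [:: 2; code_formula A; code_formula B]
    | Imp A B => [:: 3; code_formula A; code_formula B]
    end.

Definition code_option (o : option nat) : nat := if o is Some d then d.+1 else 0.

Fixpoint code_tree (T : tree) : nat :=
  CodeSeq.code
    match T with
    | As F o => [:: 0; code_formula F; code_option o]
    | Ax F o => [:: 1; code_formula F; code_option o]
    | Node F o ts =>
        [:: 2, code_formula F, code_option o & map code_tree ts]
    end.

(** * Inferences and rules *)

(* An axiom leaf is the result of an inference without premises. *)
Definition join (Ds : seq tree) (A : formula) : tree :=
  if Ds is [::] then Ax A None else Node A None Ds.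

(* The inference <<D_1, ..., D_m>, A, delta>: [extended] lists the D_i with their
   discharge functions extended by delta, i.e. with the discharges at the new
   root added.  The D_i themselves are recovered by [premises]. *)
Record inference := Inference {
  extended : seq tree;
  concl : formula;
  inferenceP : arg_structure (join extended concl)
}.

Definition premises (i : inference) : seq tree := map (trunc 0) (extended i).

Definition associated (i : inference) : tree := join (extended i) (concl i).

Definition code_inference (i : inference) : nat :=
  CodeSeq.code
    [:: code_formula (concl i); CodeSeq.code (map code_tree (extended i))].

(* R is recursive: e decides on codes of inferences whether they belong to R. *)
Definition rule (R : inference -> Prop) : Prop :=
  exists e : recfun, forall i : inference,
    (R i -> reval e [:: code_inference i] 1) /\
    (~ R i -> reval e [:: code_inference i] 0).

(* [extended i = premises i] says that nothing is discharged by the inference. *)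
Inductive introduction (i : inference) : Prop :=
  | intro_and D1 D2 of
      extended i = [:: D1; D2] & premises i = extended i &
      concl i = And (label D1) (label D2)
  | intro_or1 D B of
      extended i = [:: D] & premises i = extended i & concl i = Or (label D) B
  | intro_or2 D A of
      extended i = [:: D] & premises i = extended i & concl i = Or A (label D)
  | intro_imp D A of
      extended i = [:: D] & (forall F, (F, Some 0) \in loose_as 0 D -> F = A) &
      concl i = Imp A (label D).

(** * Reductions *)

Definition reduction_for (R : inference -> Prop) (phi : tree -> option tree) :
    Prop :=
  forall D E, phi D = Some E ->
    [/\ exists2 i, R i & D = associated i,
        arg_structure E,
        {subset open_as E <= open_as D} /\ label E = label D &
        forall sigma, assignment D sigma ->
          phi (subst sigma D) = Some (subst sigma E)].

Definition reduction (phi : tree -> option tree) : Prop :=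
  exists2 R, rule R & reduction_for R phi.

Definition redset := (tree -> option tree) -> Prop.

Definition reductions (J : redset) : Prop := forall phi, J phi -> reduction phi.

(* [replaced S E S']: in a structure having the subtree S, the sub-structure
   [trunc 0 S] is replaced by E, and S' is E with discharges at the nodes below
   put back.  Each assumption of E stands for one of S with the same label, and
   is discharged where the latter is, if it is.  An axiom leaf or a rule
   application of E can be discharged below only where one of S with the same
   labels is. *)
Definition replaced (S E S' : tree) : Prop :=
  [/\ trunc 0 S' = E,
      {subset loose_as 0 S' <= loose_as 0 S},
      {subset loose_ax 0 S' <= loose_ax 0 S} &
      {subset loose_app 0 S' <= loose_app 0 S}].

Inductive step (J : redset) : tree -> tree -> Prop :=
  | step_here phi S E S' :
      J phi -> phi (trunc 0 S) = Some E -> replaced S E S' -> step J S S'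
  | step_above F o ts1 t t' ts2 :
      step J t t' ->
      step J (Node F o (ts1 ++ t :: ts2)) (Node F o (ts1 ++ t' :: ts2)).

Definition reduces (J : redset) : tree -> tree -> Prop :=
  clos_refl_trans tree (fun D D' => step J D D' /\ arg_structure D').

(** * Validity *)

(* [CV F J B D] stands for the validity on B of <D, J> for closed D with
   conclusion F. *)
Definition valid_with (n : nat) (CV : formula -> redset -> base -> tree -> Prop)
    (J : redset) (B : base) (D : tree) : Prop :=
  if is_closed D then CV (label D) J B D
  else forall (sigma : formula -> tree) (J' : redset) (C : base),
    assignment D sigma ->
    (forall F, F \in open_as D -> is_closed (sigma F)) ->
    reductions J' -> (forall phi, J phi -> J' phi) ->
    extends n B C ->
    (forall F, F \in open_as D -> CV F J' C (sigma F)) ->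
    CV (label D) J' C (subst sigma D).

Definition valid_canonical (n : nat)
    (CV : formula -> redset -> base -> tree -> Prop)
    (J : redset) (B : base) (D : tree) : Prop :=
  exists i : inference,
    [/\ introduction i, reduces J D (associated i) &
        List.Forall (valid_with n CV J B) (premises i)].

(* In a closed canonical structure with conclusion A, the conclusions and the
   undischarged assumptions of the immediate sub-structures are immediate
   subformulas of A; so validity is by recursion on A. *)
Fixpoint closed_valid (n : nat) (A : formula) (J : redset) (B : base)
    (D : tree) {struct A} : Prop :=
  match A with
  | Atom _ => exists2 D', reduces J D D' & closed_derivation B D'
  | And A1 A2 | Or A1 A2 | Imp A1 A2 =>
      valid_canonical n
        (fun F J' C E => F = A1 /\ closed_valid n A1 J' C E
                         \/ F = A2 /\ closed_valid n A2 J' C E)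
        J B D
  end.

Definition valid_on (n : nat) (J : redset) (B : base) (D : tree) : Prop :=
  valid_with n (closed_valid n) J B D.

Definition valid (n : nat) (J : redset) (D : tree) : Prop :=
  forall B, base_level_le n B -> valid_on n J B D.

Definition alpha_consequence (n : nat) (Gamma : seq formula) (A : formula) :
    Prop :=
  exists D J, [/\ reductions J, from_to Gamma A D & valid n J D].

(* Main.v *)
Require Import Defs.
From mathcomp Require Import all_boot.
From Stdlib Require Import Relation_Operators Classical_Prop.
From Stdlib Require List.

Set Implicit Arguments.
Unset Strict Implicit.
Unset Printing Implicit Defensive.

(** A set of reductions may be non-deterministic, and open arguments are tested
    against all larger sets of reductions; so the set of all reductions can
    always be used.  Relative to it, a closed structure carries no information
    beyond its conclusion.  For, given a closed structure E with conclusion A,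
    the map sending every closed structure with conclusion A to E is a reduction
    for the rule that has all inferences as instances ([constant_reduction]): it
    commutes with substitutions since these do not affect closed structures.  So
    any closed structure reduces to any other one with the same conclusion
    ([reduces_closed]).

    It follows, by induction on A, that relative to all reductions a closed
    structure with conclusion A is valid on a base exactly if A holds on that
    base ([closed_valid_sat]).  That validity implies truth is shown for every
    set of reductions: where a canonical structure for A1 -> A2 has an open
    premise, one passes to the set of all reductions, and substitutes for A1 an
    axiom leaf, which is valid by the converse for A1.  For the converse, the
    given structure is reduced to a closed derivation in the base, or to a
    canonical structure whose premises infer their conclusion in one step.

    Hence Gamma |= A is witnessed by the one-step inference from Gamma to A
    together with all reductions ([valid_one_step]); and a valid argument from
    Gamma to A yields Gamma |= A if axiom leaves are substituted for its
    assumptions ([valid_with_sound]). *)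

(** * Trees *)

Lemma tree_nested_ind (P : tree -> Prop) :
  (forall F o, P (As F o)) ->
  (forall F o, P (Ax F o)) ->
  (forall F o ts, List.Forall P ts -> P (Node F o ts)) ->
  forall T, P T.
Proof.
move=> HAs HAx HNode; fix IH 1; case=> [F o|F o|F o ts]; first exact: HAs.
  exact: HAx.
apply: HNode; elim: ts => [|t ts IHts]; constructor; [exact: IH | exact: IHts].
Qed.

Lemma label_trunc k T : label (trunc k T) = label T.
Proof. by case: T. Qed.

(** Truncation discards no assumption: those discharged below the root become
    undischarged. *)
Lemma loose_as_trunc k T :
  loose_as k (trunc k T) = [seq (x.1, None) | x <- loose_as k T].
Proof.
elim/tree_nested_ind: T k => [F [d|]|F o|F o ts IHts] k //=.
  by case: ifP => [dk|_] //=; rewrite dk.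
by elim: IHts => [|t ts' Ht _ IH] //=; rewrite Ht IH map_cat.
Qed.

Lemma open_as_trunc T : open_as (trunc 0 T) = open_as T.
Proof. by rewrite /open_as loose_as_trunc -map_comp. Qed.

(** How an undischarged or outwardly discharged assumption of an immediate
    subtree is seen from the root of the whole tree: distances decrease by one,
    and an assumption discharged at that root disappears. *)
Definition lower (x : formula * option nat) : option (formula * option nat) :=
  match x with
  | (F, None) => Some (F, None)
  | (F, Some 0) => None
  | (F, Some j.+1) => Some (F, Some j)
  end.

Lemma loose_asS k T : loose_as k.+1 T = pmap lower (loose_as k T).
Proof.
elim/tree_nested_ind: T k => [F [d|]|F o|F o ts IHts] k //=.
  case: (ltngtP d k) => [dk|kd|->] /=; first by rewrite ltnS ltnW.
    rewrite ltnS leqNgt kd /= subnS.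
    by case: (d - k) (subn_gt0 k d) => [|j]; rewrite ?kd.
  by rewrite ltnSn subnn.
by elim: IHts => [|t ts' Ht _ IH] //=; rewrite Ht IH pmap_cat.
Qed.

Lemma is_closedP T : is_closed T -> loose_as 0 T = [::].
Proof. by rewrite /is_closed /open_as; case: (loose_as 0 T). Qed.

Lemma loose_as_closed k T : is_closed T -> loose_as k T = [::].
Proof.
by move=> /is_closedP cT; elim: k => // k IH; rewrite loose_asS IH.
Qed.

(** The value of [rule_node] at the root is generalized to b, because it depends
    on the list of all subtrees and so hinders inductions on this list. *)
Lemma wf_Node ctx F o ts : wf ctx (Node F o ts) ->
  is_true (if o is Some d then nth false ctx d else true) /\
  exists b, all (wf (b :: ctx)) ts.
Proof.
case/and3P=> _ Ho Hts; split; last by exists (rule_node (Node F o ts)).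
by case: o Ho {Hts} => // d /andP[].
Qed.

Lemma cut_wf ctx o :
  is_true (if o is Some d then nth false ctx d else true) ->
  cut (size ctx) o = o.
Proof. by case: o => //= d; case: ltnP => // dk; rewrite nth_default. Qed.

Lemma trunc_wf ctx T : wf ctx T -> trunc (size ctx) T = T.
Proof.
elim/tree_nested_ind: T ctx => [F [d|]|F o|F o ts IHts] ctx //.
- by move=> /= ->.
- by move=> /cut_wf /= ->.
case/wf_Node=> /cut_wf /= -> [b Hts]; congr Node.
by elim: IHts Hts => [|t ts' Ht _ IH] //= /andP[/Ht/= -> /IH->].
Qed.

Lemma trunc_arg T : arg_structure T -> trunc 0 T = T.
Proof. exact: trunc_wf. Qed.

Lemma outer_wf ctx o :
  is_true (if o is Some d then nth false ctx d else true) ->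
  outer (size ctx) o = [::].
Proof. by case: o => //= d; case: ltnP => // dk; rewrite nth_default. Qed.

Lemma loose_ax_wf ctx T : wf ctx T -> loose_ax (size ctx) T = [::].
Proof.
elim/tree_nested_ind: T ctx => [F o|F o|F o ts IHts] ctx //.
  by move=> /outer_wf /= ->.
case/wf_Node=> _ [b] /=.
by elim: IHts => [|t ts' Ht _ IH] //= /andP[/Ht/= -> /IH->].
Qed.

Lemma loose_app_wf ctx T : wf ctx T -> loose_app (size ctx) T = [::].
Proof.
elim/tree_nested_ind: T ctx => [F o|F o|F o ts IHts] ctx //.
case/wf_Node=> /outer_wf /= -> [b] /=.
by elim: IHts => [|t ts' Ht _ IH] //= /andP[/Ht/= -> /IH->].
Qed.

Lemma wf_cat ctx ctx' T : wf ctx T -> wf (ctx ++ ctx') T.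
Proof.
have nth_ctx d : nth false ctx d -> nth false (ctx ++ ctx') d.
  by rewrite nth_cat; case: ltnP => // dk; rewrite nth_default.
elim/tree_nested_ind: T ctx nth_ctx
  => [F [d|]|F [d|]|F o ts IHts] ctx nth_ctx //=.
- by move=> dk; rewrite size_cat ltn_addr.
- exact: nth_ctx.
case/and3P=> -> Ho Hts; apply/and3P; split=> //.
  by case: o Ho {Hts} => // d /andP[-> /nth_ctx].
rewrite -cat_cons.
have : forall d, nth false (rule_node (Node F o ts) :: ctx) d ->
         nth false ((rule_node (Node F o ts) :: ctx) ++ ctx') d.
  by case=> [|d] //=; exact: nth_ctx.
move: (rule_node _ :: ctx) Hts => ctx1 Hts Hctx1.
by elim: IHts Hts => [|t ts' Ht _ IH] //= /andP[/(Ht _ Hctx1)-> /IH->].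
Qed.

(** * Substitution *)

Lemma subst_no_assumption sigma k T :
  (forall F, (F, None) \notin loose_as k T) -> subst sigma T = T.
Proof.
elim/tree_nested_ind: T k => [F [d|]|F o|F o ts IHts] k //= H.
  by have /= := H F; rewrite inE eqxx.
congr Node; elim: IHts H => [|t ts' Ht _ IH] //= H.
rewrite (Ht k.+1) ?IH // => G; have := H G;
  by rewrite mem_cat negb_or => /andP[].
Qed.

Lemma subst_closed sigma T : is_closed T -> subst sigma T = T.
Proof.
by move=> cT; apply: (@subst_no_assumption _ 0) => F; rewrite loose_as_closed.
Qed.

Lemma loose_as_subst sigma k T :
  (forall F, F \in map fst (loose_as k T) -> is_closed (sigma F)) ->
  loose_as k (subst sigma (trunc k T)) = [::].
Proof.
elim/tree_nested_ind: T k => [F [d|]|F o|F o ts IHts] k //= H.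
- by case: ifP H => [dk|_] //= H; rewrite ?dk // loose_as_closed ?H ?inE.
- by rewrite loose_as_closed ?H ?inE.
elim: IHts H => [|t ts' Ht _ IH] //= H.
by rewrite Ht ?IH // => G HG; apply: H; rewrite map_cat mem_cat HG ?orbT.
Qed.

Lemma is_closed_subst sigma T :
  (forall F, F \in open_as T -> is_closed (sigma F)) ->
  is_closed (subst sigma (trunc 0 T)).
Proof. by move=> H; rewrite /is_closed /open_as loose_as_subst. Qed.

Lemma label_subst sigma T :
  assignment T sigma -> label (subst sigma T) = label T.
Proof.
case: T => [F [d|]|F o|F o ts] //= H.
by have [|_ ->] // := H F; rewrite inE.
Qed.

(** * Reductions *)

Lemma subset_pmap (S T : eqType) (f : S -> option T) (s1 s2 : seq S) :
  {subset s1 <= s2} -> {subset pmap f s1 <= pmap f s2}.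
Proof.
move=> H y; rewrite !mem_pmap => /mapP[x /H xs ->]; exact: map_f.
Qed.

Lemma step_invariant J T T' : reductions J -> step J T T' ->
  label T' = label T /\ {subset loose_as 0 T' <= loose_as 0 T}.
Proof.
move=> HJ; elim=> [phi S E S' /HJ[R _ redR] phiE [trE sub _ _]
                  |F o ts1 t t' ts2 _ [_ IH]].
  have [_ _ [_ lab] _] := redR _ _ phiE.
  by split=> //; rewrite -(label_trunc 0 S') trE lab label_trunc.
split=> //= x; rewrite !map_cat !flatten_cat /= !mem_cat.
case/orP=> [->|/orP[|->]]; rewrite ?orbT // !loose_asS.
by move=> /(subset_pmap IH)->; rewrite orbT.
Qed.

Lemma reduces_invariant J T T' : reductions J -> reduces J T T' ->
  label T' = label T /\ (is_closed T -> is_closed T').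
Proof.
move=> HJ; elim=> [{}T {}T' [/(step_invariant HJ)[lab sub] _]|//
                  |x y z _ [lxy cxy] _ [lyz cyz]].
  split=> // /is_closedP cT; rewrite /is_closed /open_as.
  case: (loose_as 0 T') sub => // x s /(_ x).
  by rewrite cT inE eqxx => /(_ isT).
by split; [rewrite lyz | move=> /cxy/cyz].
Qed.

Lemma rule_all : rule (fun=> True).
Proof.
exists (RComp RSucc [:: RZero]) => i; split=> // _.
by apply: (rev_comp (w := [:: 0])); [apply: revs_cons|]; constructor.
Qed.

Lemma closed_associated D : arg_structure D -> is_closed D ->
  exists i, D = associated i.
Proof.
case: D => [F o|F [d|]|F [d|] [|t ts]] // wD cD.
- by case: o wD cD.
- by move: wD; rewrite /arg_structure /= nth_nil.
- by exists (@Inference [::] F wD).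
- by case/wf_Node: wD; rewrite nth_nil.
- by exists (@Inference (t :: ts) F wD).
Qed.

(** The map that is defined on the closed structures with the same conclusion as
    E, with constant value E. *)
Definition constant (E : tree) (D : tree) : option tree :=
  if [&& arg_structure D, is_closed D & label D == label E]
  then Some E else None.

Lemma constant_reduction E :
  arg_structure E -> is_closed E -> reduction (constant E).
Proof.
move=> wE cE; exists (fun=> True); first exact: rule_all.
move=> D E'; rewrite /constant; case: and3P => // -[wD cD /eqP lab] [<-].
split=> //.
- by have [i ->] := closed_associated wD cD; exists i.
- by rewrite lab; split=> // x; rewrite /open_as (is_closedP cE).
by move=> sigma _; rewrite !subst_closed // wD cD lab eqxx.
Qed.

Lemma reduces_closed (J : redset) D E :
  (forall phi, reduction phi -> J phi) ->
  arg_structure D -> is_closed D -> arg_structure E -> is_closed E ->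
  label D = label E -> reduces J D E.
Proof.
move=> HJ wD cD wE cE lab; apply: rt_step; split=> //.
apply: (@step_here _ (constant E) _ E); first exact/HJ/constant_reduction.
  by rewrite trunc_arg // /constant wD cD lab eqxx.
split; rewrite ?trunc_arg ?(is_closedP cE) //.
  by rewrite (loose_ax_wf (ctx := [::])).
by rewrite (loose_app_wf (ctx := [::])).
Qed.

(** * Derivations *)

Scheme derivation_mut := Minimality for derivation Sort Prop
with derivations_mut := Minimality for derivations Sort Prop.

Lemma wf_NodeI ctx F o ts : ts <> [::] -> rule_node (Node F o ts) ->
  is_true (if o is Some d then nth false ctx d else true) ->
  all (wf (true :: ctx)) ts -> wf ctx (Node F o ts).
Proof.
move=> ts0 rn Ho Hts; apply/and3P; split.
- by case: ts ts0 {rn Hts}.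
- by case: o Ho rn => // d Hd ->.
- by move: rn => /= ->.
Qed.

(** A derivation is an argument structure without assumptions, if the nodes
    below it are rule nodes.  Its own inner nodes are such nodes because they
    are not values of f, whence the clause about [f_hits]. *)
Lemma derivation_arg B ctx T a : derivation B ctx T a ->
  [/\ label T = Atom a, forall k, loose_as k T = [::], forall k, ~~ f_hits k T
    & wf (nseq (size ctx) true) T].
Proof.
have ctx_true ctx' r o : applied B ctx' r o ->
    is_true (if o is Some d then nth false (nseq (size ctx') true) d else true).
  case: o => //= d; rewrite nth_nseq; case: ltnP => // kd.
  by rewrite nth_default.
pose P ctx T a :=
  [/\ label T = Atom a, forall k, loose_as k T = [::], forall k, ~~ f_hits k T
    & wf (nseq (size (ctx : seq (seq arule))) true) T].
pose Q (ctx : seq (seq arule)) (ps : seq (seq arule * atom)) ts :=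
  [/\ size ts = size ps, all (fun t => atomic (label t)) ts,
      forall k, flatten (map (loose_as k) ts) = [::],
      forall k, ~~ has (f_hits k) ts &
      all (wf (true :: nseq (size ctx) true)) ts].
move: ctx T a; apply: (@derivation_mut B P Q)
  => [ctx a o|ctx p ps a o ts|ctx|ctx R a ps t ts _].
- by move=> /ctx_true.
- move=> /ctx_true Ho _ _ [sz Hat Has Hf Hwf].
  split=> // [k|k|]; [exact: Has | exact: Hf | apply: wf_NodeI => //].
  - by move=> ts0; rewrite ts0 in sz.
  - by rewrite /rule_node Hat Hf.
- by [].
move=> [lab Has Hf Hwf] _ [sz Hat Has' Hf' Hwf'].
split=> /= [||k|k|]; rewrite ?sz ?lab ?negb_or ?Has ?Has' ?Hf ?Hf' ?Hwf //.
Qed.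

(** The tree may change: an assumed rule of a derivation in B that belongs to C
    has to be applied as a rule of C. *)
Lemma derivation_mono (B C : base) ctx T a : (forall r, B r -> C r) ->
  derivation B ctx T a -> exists T', derivation C ctx T' a.
Proof.
move=> BC.
have avail ctx' r o : applied B ctx' r o ->
    exists o', applied C ctx' r o' /\ (o' <> None -> ~ C r).
  case: (classic (C r)) => [Cr|nCr]; first by exists None.
  by case: o => [d|/= /BC] // Hd; exists (Some d).
move: ctx T a; apply: (@derivation_mut B
  (fun ctx _ a => exists T', derivation C ctx T' a)
  (fun ctx ps _ => exists ts', derivations C ctx ps ts')) =>
  [ctx a o /avail[o' [Ho' _]]|ctx p ps a o ts /avail[o' [Ho' nC]] _ _ [ts' Hts']
  |ctx|ctx R a ps t ts _ [t' Ht'] _ [ts' Hts']].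
- by exists (Ax (Atom a) o'); constructor.
- by exists (Node (Atom a) o' ts'); apply: der_node Hts'.
- by exists [::]; constructor.
- by exists (t' :: ts'); constructor.
Qed.

Lemma sat_mono n A B C : extends n B C -> sat n A B -> sat n A C.
Proof.
move=> BC; elim: A => [a|A1 IH1 A2 IH2|A1 IH1 A2 IH2|A1 _ A2 _] /=.
- by case=> T; apply: derivation_mono; case: BC.
- by case=> /IH1 ? /IH2.
- by case=> [/IH1|/IH2]; [left | right].
move=> H D [CD lD]; apply: H; split=> // r Br.
by apply: CD; case: BC => /(_ r Br).
Qed.

(** * Validity and satisfaction *)

(** CV stands for the validity of closed structures, as in [valid_with].  It is
    sound for A if A holds wherever a closed structure with conclusion A is
    valid relative to some set of reductions. *)
Definition sound n (CV : formula -> redset -> base -> tree -> Prop)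
    (A : formula) : Prop :=
  forall J B D, reductions J -> is_closed D -> label D = A ->
    CV A J B D -> sat n A B.

(** CV is complete for A if, wherever A holds, all closed structures with
    conclusion A are valid relative to every set containing all reductions. *)
Definition complete n (CV : formula -> redset -> base -> tree -> Prop)
    (A : formula) : Prop :=
  forall J B D, (forall phi, reduction phi -> J phi) ->
    arg_structure D -> is_closed D -> label D = A -> sat n A B -> CV A J B D.

(** The structure that infers A from the assumptions Gamma in a single step. *)
Definition one_step (Gamma : seq formula) (A : formula) : tree :=
  join [seq As F None | F <- Gamma] A.

Lemma from_to_one_step Gamma A : from_to Gamma A (one_step Gamma A).
Proof.
case: Gamma => // F Gamma; split=> //.
  by apply/and3P; split=> //; rewrite all_map; apply/allP.
move=> G; rewrite /open_as /= !inE; congr (_ || _).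
by elim: Gamma => //= H Gamma' IH; rewrite !inE IH.
Qed.

Lemma subst_one_step sigma Gamma A :
  assignment (one_step Gamma A) sigma ->
  (forall F, F \in open_as (one_step Gamma A) -> is_closed (sigma F)) ->
  arg_structure (subst sigma (one_step Gamma A)) /\
  is_closed (subst sigma (one_step Gamma A)).
Proof.
have [w opn lab] := from_to_one_step Gamma A => ass cls; split; last first.
  by rewrite -(trunc_arg w); apply: is_closed_subst.
case: Gamma opn {w lab cls} ass => // F Gamma opn ass.
apply/and3P; split=> //; rewrite -map_comp all_map; apply/allP => G GG /=.
by apply: (@wf_cat [::]); have [] := ass G; rewrite ?opn.
Qed.

(** The bare inference from Gamma to A is valid as soon as the consequence
    holds, because all reductions are at hand. *)
Lemma valid_one_step n CV J B Gamma A :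
  (forall phi, reduction phi -> J phi) ->
  (forall F, sound n CV F) -> complete n CV A ->
  consequence_on n B Gamma A -> valid_with n CV J B (one_step Gamma A).
Proof.
move=> HJ snd cmp cons; have [_ opn lab] := from_to_one_step Gamma A.
rewrite /valid_with lab; case: ifP => [cls|opn'].
  case: Gamma cls opn cons {lab} => [|F Gamma] cls opn //= cons.
  exact: cmp.
move=> sigma J' C ass cls HJ' JJ' BC val.
have [w c] := subst_one_step ass cls.
apply: cmp => //; [by move=> phi /HJ/JJ' | by rewrite label_subst |].
case: Gamma opn opn' cons {lab w c} ass cls val
  => // F Gamma opn _ cons ass cls val.
apply: cons => // G; rewrite -opn => GG; have [_ lab] := ass _ GG.
by apply: (snd G J' C (sigma G)); auto.
Qed.

Lemma valid_with_sound n CV J B D Gamma :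
  sound n CV (label D) -> (forall F, F \in Gamma -> complete n CV F) ->
  reductions J ->
  open_as D =i Gamma -> valid_with n CV J B (trunc 0 D) ->
  consequence_on n B Gamma (label D).
Proof.
move=> snd cmp HJ opn; rewrite /valid_with /is_closed open_as_trunc label_trunc.
case: nilP => [D0|Dn0].
  move=> val; have {opn} -> : Gamma = [::].
    by case: Gamma opn {cmp} => // F Gamma /(_ F); rewrite D0 inE eqxx.
  apply: snd val; rewrite ?label_trunc // /is_closed open_as_trunc.
  by rewrite D0.
case: Gamma opn cmp => [opn|F Gamma opn cmp val].
  by case: (open_as D) opn Dn0 => // F s /(_ F); rewrite inE eqxx.
move=> C BC satC; pose leaf F := Ax F None.
have ass : assignment (trunc 0 D) leaf by [].
apply: (snd reduction C (subst leaf (trunc 0 D))) => //.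
- exact: is_closed_subst.
- by rewrite (label_subst ass) label_trunc.
apply: val => // G; rewrite opn => GG.
by apply: cmp => //; exact: satC.
Qed.

(** * Canonical structures *)

Lemma label_associated i : label (associated i) = concl i.
Proof. by rewrite /associated; case: (extended i). Qed.

Lemma associated_closed i : is_closed (associated i) ->
  List.Forall (fun D => loose_as 1 D = [::]) (extended i).
Proof.
move=> /is_closedP; rewrite /associated; case: (extended i) => [|D Ds] //=.
rewrite -[_ ++ _]/(flatten (map (loose_as 1) (D :: Ds))).
elim: {D Ds}(D :: Ds) => [|D Ds IH] //= e.
by case e1: (loose_as 1 D) e => //= e; constructor; [exact: e1 | exact: IH].
Qed.

(** The hypothesis says that every assumption of the subtree D is discharged
    within D or at the node immediately below D. *)
Lemma discharged_at_root D F :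
  loose_as 1 D = [::] -> F \in open_as D -> (F, Some 0) \in loose_as 0 D.
Proof.
move=> e /mapP[[G o] Gin /= ->]; move: e Gin; rewrite loose_asS.
case: o => [[|j]|] // e Gin.
  by have := map_f lower Gin; rewrite /= -mem_pmap e.
by have := map_f lower Gin; rewrite /= -mem_pmap e.
Qed.

Lemma open_as_undischarged D :
  trunc 0 D = D -> loose_as 1 D = [::] -> open_as D = [::].
Proof.
move=> trD e; case opn: (open_as D) => [//|F s].
have : F \in open_as D by rewrite opn inE eqxx.
by move=> /(discharged_at_root e); rewrite -trD loose_as_trunc => /mapP[].
Qed.

(** Completeness is needed only for the antecedent of an implication, which is
    the only formula that can be an assumption of a premise. *)
Lemma valid_canonical_sound n CV J B D :
  (forall F, sound n CV F) ->
  (forall A1 A2, label D = Imp A1 A2 -> complete n CV A1) ->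
  reductions J -> is_closed D -> valid_canonical n CV J B D ->
  sat n (label D) B.
Proof.
move=> snd cmp HJ clD [i [intro red val]].
have [lab /(_ clD)] := reduces_invariant HJ red.
rewrite label_associated in lab; rewrite -{}lab in cmp *.
move=> /associated_closed; move: val; rewrite /premises.
have undischarged D' : trunc 0 D' = D' -> loose_as 1 D' = [::] ->
    valid_with n CV J B (trunc 0 D') -> sat n (label D') B.
  move=> trD e; apply: (valid_with_sound (Gamma := [::])) => //.
  by rewrite open_as_undischarged.
case: intro => [D1 D2 E|D1 A2 E|D1 A1 E|D1 A1 E].
- rewrite /premises E => -[tr1 tr2] -> /List.Forall_cons_iff[v1].
  move=> /List.Forall_cons_iff[v2 _] /List.Forall_cons_iff[e1].
  by move=> /List.Forall_cons_iff[e2 _]; split; exact: undischarged.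
- rewrite /premises E => -[tr1] -> /List.Forall_cons_iff[v1 _].
  by move=> /List.Forall_cons_iff[e1 _]; left; exact: undischarged.
- rewrite /premises E => -[tr1] -> /List.Forall_cons_iff[v1 _].
  by move=> /List.Forall_cons_iff[e1 _]; right; exact: undischarged.
move=> dis ci; rewrite E => /List.Forall_cons_iff[v1 _].
move=> /List.Forall_cons_iff[e1 _].
have opn F : F \in open_as D1 -> F = A1 by move=> /(discharged_at_root e1)/dis.
rewrite ci => C BC sat1.
have : consequence_on n B (open_as D1) (label D1).
  by apply: (valid_with_sound (snd _)) v1 => // F /opn ->; exact: cmp ci.
(* The discharge may be vacuous, and then A2 holds on B already. *)
case: (open_as D1) opn => [|F s] opn /= cons; first exact: sat_mono BC cons.
by apply: cons => // G /opn ->.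
Qed.

Lemma valid_canonical_complete n CV A1 A2 A J B D :
  A \in [:: And A1 A2; Or A1 A2; Imp A1 A2] ->
  (forall F, sound n CV F) -> complete n CV A1 -> complete n CV A2 ->
  (forall phi, reduction phi -> J phi) ->
  arg_structure D -> is_closed D -> label D = A -> sat n A B ->
  valid_canonical n CV J B D.
Proof.
move=> HA snd cmp1 cmp2 HJ wD cD lab satA.
have premise Gamma F : complete n CV F -> consequence_on n B Gamma F ->
    valid_with n CV J B (one_step Gamma F) by exact: valid_one_step.
pose leaf F := one_step [::] F.
move: HA satA; rewrite !inE => /or3P[] /eqP HA; rewrite {}HA in lab *.
- move=> [sat1 sat2].
  have i_ok : arg_structure (join [:: leaf A1; leaf A2] (And A1 A2)) by [].
  exists (Inference i_ok); split; [|exact: reduces_closed|].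
    exact: (@intro_and _ (leaf A1) (leaf A2)).
  by do 2!(apply: List.Forall_cons; first exact: (premise [::])).
- case=> [sat1|sat2].
    have i_ok : arg_structure (join [:: leaf A1] (Or A1 A2)) by [].
    exists (Inference i_ok); split; [|exact: reduces_closed|].
      exact: (@intro_or1 _ (leaf A1) A2).
    by apply: List.Forall_cons; first exact: (premise [::]).
  have i_ok : arg_structure (join [:: leaf A2] (Or A1 A2)) by [].
  exists (Inference i_ok); split; [|exact: reduces_closed|].
    exact: (@intro_or2 _ (leaf A2) A1).
  by apply: List.Forall_cons; first exact: (premise [::]).
move=> satA.
(* [Some 1] is the root; at distance 0 there is the inference of A2 from A1. *)
have i_ok : arg_structure
  (join [:: Node A2 None [:: As A1 (Some 1)]] (Imp A1 A2)) by [].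
exists (Inference i_ok); split; [|exact: reduces_closed|].
  apply: (@intro_imp _ (Node A2 None [:: As A1 (Some 1)]) A1) => // F.
  by rewrite inE => /eqP[].
apply: List.Forall_cons => //; apply: (premise [:: A1]) => // C BC sat1.
by apply: satA => //; apply: sat1; rewrite inE.
Qed.

Lemma closed_valid_sat n A :
  sound n (closed_valid n) A /\ complete n (closed_valid n) A.
Proof.
(* CV is what [closed_valid] passes to [valid_canonical]. *)
have subformulas A1 A2 (CV := fun F J C E => F = A1 /\ closed_valid n A1 J C E
                                \/ F = A2 /\ closed_valid n A2 J C E) :
    sound n (closed_valid n) A1 /\ complete n (closed_valid n) A1 ->
    sound n (closed_valid n) A2 /\ complete n (closed_valid n) A2 ->
    [/\ forall F, sound n CV F, complete n CV A1 & complete n CV A2].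
  move=> [s1 c1] [s2 c2]; split.
  - by move=> F J B D HJ cD lab [] [FA]; rewrite FA in lab *;
      [exact: s1 lab | exact: s2 lab].
  - by left; split=> //; exact: c1.
  - by right; split=> //; exact: c2.
elim: A => [a|A1 H1 A2 H2|A1 H1 A2 H2|A1 H1 A2 H2].
- split=> [J B D HJ cD lab [D' red [b der]]|J B D HJ wD cD lab [D' der]].
    exists D'; have [lab' _] := reduces_invariant HJ red.
    have [labD' _ _ _] := derivation_arg der.
    by move: labD'; rewrite lab' lab => -[->].
  have [lab' as' _ wf'] := derivation_arg der.
  exists D'; last by exists a.
  by apply: reduces_closed; rewrite // ?lab // /is_closed /open_as as'.
all: have [snd cmp1 cmp2] := subformulas _ _ H1 H2.
all: split=> [J B D HJ cD lab val|J B D HJ wD cD lab satA].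
all: try by rewrite -lab; apply: valid_canonical_sound val;
  rewrite // lab // => ? ? [<-].
all: apply: (valid_canonical_complete _ snd cmp1 cmp2 HJ wD cD lab satA).
all: by rewrite !inE eqxx ?orbT.
Qed.

Theorem theorem2 (n : nat) (Gamma : seq formula) (A : formula) :
  consequence n Gamma A <-> alpha_consequence n Gamma A.
Proof.
split=> [cons|[D [J [HJ [wD opn <-] val]]] B lB].
  exists (one_step Gamma A), reduction.
  split=> //; first exact: from_to_one_step.
  move=> B lB; apply: valid_one_step => //; last exact: cons.
  - by move=> F; have [] := closed_valid_sat n F.
  - by have [] := closed_valid_sat n A.
have [snd _] := closed_valid_sat n (label D).
apply: (valid_with_sound snd _ HJ opn).
  by move=> F _; have [] := closed_valid_sat n F.
by rewrite trunc_arg //; exact: val.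
Qed.
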